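(* Let $k\ge 3$ and let $BT_{4k}$ be a decomposable $k$-regular bipartite tournament (on $4k$ vertices). If $BT_{4k}$ is not isomorphic to the digraph $D$ on vertex set $\{1,2,\dots,4k\}$ (indices taken modulo $4k$) which has the Hamiltonian cycle $(1,2,3,\dots,4k,1)$ and satisfies $(4m+i-1,i)\in A(D)$ and $(i,4m+i+1)\in A(D)$ for all vertices $i$ and all $m$ with $1\le m\le k-1$, then $BT_{4k}$ contains $D(4k,p)$ for every $p$ with $2\le p\le 4k$.
   Context: A digraph is $k$-regular if every vertex has in-degree and out-degree $k$; a $k$-regular bipartite tournament has $4k$ vertices. For integers $n\ge 3$ and $2\le p\le n$, $D(n,p)$ denotes the digraph obtained from a directed $n$-cycle by reversing the orientations of $p-1$ consecutive arcs; equivalently, it is the union of a directed path $(a_1,a_2,\dots,a_p)$ and a directed path $(a_1,b_1,\dots,b_{n-p},a_p)$ on $n$ distinct vertices. A digraph on $n$ vertices ''contains $D(n,p)$'' if it has a (spanning) subdigraph isomorphic to $D(n,p)$. Decomposable $k$-regular bipartite tournaments are defined inductively: a decomposable $1$-regular bipartite tournament $BT_4$ is a directed cycle of length $4$; for $k\ge 2$, a decomposable $k$-regular bipartite tournament $BT_{4k}$ is a $k$-regular bipartite tournament obtained from a vertex-disjoint decomposable $1$-regular bipartite tournament $BT_4$ and a decomposable $(k-1)$-regular bipartite tournament $BT_{4(k-1)}$ by adding arcs (between them). The notation $(u,v)\in A(D)$ means $D$ has the arc from $u$ to $v$. *)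

(* Defs.v *)
From mathcomp Require Import all_boot.

Set Implicit Arguments.
Unset Strict Implicit.
Unset Printing Implicit Defensive.

(* A digraph on the finite vertex type T is given by its arc relation
   e : rel T, where e x y means that (x, y) is an arc. *)

Definition digraph_iso (T1 T2 : finType) (e1 : rel T1) (e2 : rel T2) : Prop :=
  exists2 f : T1 -> T2, bijective f & forall x y, e2 (f x) (f y) = e1 x y.

Definition induced (T : finType) (e : rel T) (S : {set T}) :
    rel {x : T | x \in S} := fun x y =>
  e (val x) (val y).
Arguments induced T e S _ _ : clear implicits.

Definition contains_spanning (T H : finType) (e : rel T) (h : rel H) : Prop :=
  exists2 s : rel T, subrel s e & digraph_iso h s.

Definition regular_digraph (T : finType) (k : nat) (e : rel T) : Prop :=
  forall x, #|[set y | e y x]| = k /\ #|[set y | e x y]| = k.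

Definition bipartite_tournament (T : finType) (e : rel T) : Prop :=
  exists A : {set T},
    (forall x y, (x \in A) = (y \in A) -> ~~ e x y) /\
    (forall x y, x \in A -> y \notin A -> e x y (+) e y x).

Definition dicycle (n : nat) : rel 'I_n := fun x y => x.+1 == y %[mod n].
Arguments dicycle n _ _ : clear implicits.

(* The arcs x -> x + 1 of the directed n-cycle with x < p - 1 are the p - 1
   reversed ones. In terms of the two paths, a_1 = p - 1 and a_p = 0: they are
   (p - 1, p - 2, .., 0) and (p - 1, p, .., n - 1, 0). *)
Definition Dnp (n p : nat) : rel 'I_n := fun x y =>
  ((p.-1 <= x) && dicycle n x y) || ((y < p.-1) && dicycle n y x).
Arguments Dnp n p _ _ : clear implicits.

(* "Obtained by adding arcs between two vertex-disjoint digraphs" means that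
   the two digraphs are those induced on complementary sets S and ~: S. *)
Fixpoint decomposable_bt (k : nat) (T : finType) (e : rel T) : Prop :=
  match k with
  | 0 => False
  | 1 => digraph_iso e (dicycle 4)
  | (_.+1 as j).+1 =>
      [/\ bipartite_tournament e, regular_digraph k e &
          exists S : {set T},
            digraph_iso (induced T e S) (dicycle 4) /\
            decomposable_bt j (induced T e (~: S))]
  end.

(* Vertices are the residues modulo 4k. The arc (4m + i - 1, i) is written
   x + 1 = 4m + y mod 4k with (x, y) = (4m + i - 1, i), which avoids the
   truncated subtraction. *)
Definition exceptional (k : nat) : rel 'I_(4 * k) := fun x y =>
  dicycle (4 * k) x y ||
  [exists m : 'I_k, (1 <= m) &&
    ((x.+1 == 4 * m + y %[mod 4 * k]) || (y == 4 * m + x + 1 %[mod 4 * k]))].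
Arguments exceptional k _ _ : clear implicits.

(* Main.v *)
Require Import Defs.
From mathcomp Require Import all_boot zify_ssreflect.

Set Implicit Arguments.
Unset Strict Implicit.
Unset Printing Implicit Defensive.

(* Peel off a 4-cycle C of a decomposable tournament. Regularity forces every
   remaining vertex v to have exactly one in-neighbour and one out-neighbour on
   C, so v has a type in Z/4: the position on C that it could take. An arc
   u -> v off C changes the type by +1 or -1. In the first case C can be
   inserted as a whole between u and v; three consecutive arcs of the second
   kind absorb C in two halves. Hence any path with three arcs absorbs C, and
   two internally disjoint paths with the same ends (which is what D(n,p) is)
   extend from BT_4(k-1) to BT_4k by lengthening the longer one.

   The exceptional digraph is the blow-up of the 4-cycle by independent k-sets.
   If the rest of BT_4k is such a blow-up but BT_4k is not, then C together with
   two transversal 4-cycles of the blow-up already spans a non-exceptional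
   12-vertex tournament, and the other transversals are inserted into arcs of
   the blow-up. Both this case and the base k = 3 thus reduce to 12-vertex
   tournaments, which are described by 12 bits and settled by an explicit table
   of spanning subdigraphs. *)

(** * Pairs of internally disjoint paths with common ends *)

(** The path form of D(n,p): [x] is a_1, [y] is a_p, and the interior sizes are [i = p - 2] and
    [j = n - p]. Unlike [p], these two sizes play symmetric roles. *)
Definition theta (T : eqType) (e : rel T) (i j : nat) : Prop :=
  exists x y s t,
    [/\ uniq (x :: y :: s ++ t), size s = i, size t = j,
        path e x (rcons s y) & path e x (rcons t y)].

Lemma theta_sym (T : eqType) (e : rel T) i j : theta e i j -> theta e j i.
Proof.
move=> [x [y [s [t [U Ss St Ps Pt]]]]]; exists x, y, t, s; split=> //.
rewrite (perm_uniq (_ : perm_eq _ (x :: y :: s ++ t))) //.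
by rewrite !perm_cons perm_catC.
Qed.

Lemma theta_contains (T : finType) (e : rel T) n p :
  #|T| = n -> 2 <= p <= n -> theta e (p - 2) (n - p) ->
  contains_spanning e (Dnp n p).
Proof.
move=> cT /andP [p2 pn] [x [y [s [t [U Ss St Ps Pt]]]]].
(* The vertices in the cyclic order of [Dnp]: [y] gets number 0 and [x] gets number [p - 1]. The
   reversed arcs then run along [s], the others along [t] and from the last entry back to [y]. *)
pose L := y :: rev s ++ x :: t.
have UL : uniq L.
  rewrite (perm_uniq (_ : perm_eq _ (x :: y :: s ++ t))) //.
  by apply/permP=> a; rewrite /= !count_cat /= count_rev; lia.
have sL : size L = n by rewrite /= size_cat size_rev /= Ss St; lia.
pose f (i : 'I_n) := nth y L i.
have fi : injective f.
  move=> i j /eqP; rewrite /f nth_uniq ?sL ?ltn_ord // => /eqP.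
  exact: val_inj.
have fb : bijective f by apply: inj_card_bij => //; rewrite card_ord cT.
have [g fK gK] := fb.
exists (fun u v => Dnp n p (g u) (g v)); last first.
  by exists f => // u v; rewrite !fK.
have backward i : i < p.-1 -> e (nth y L i.+1) (nth y L i).
  move=> ip; have := Ps.
  have -> : path e x (rcons s y) = sorted e (rev (y :: rev s ++ [:: x])).
    by rewrite rev_cons rev_cat revK.
  rewrite rev_sorted; set M := y :: _ => PM.
  have sM : size M = p by rewrite /= size_cat size_rev Ss /=; lia.
  have LM j : j < p -> nth y L j = nth y M j.
    by move=> jp; rewrite -[L]/((y :: rev s) ++ [:: x] ++ t) catA nth_cat sM jp.
  rewrite !LM; try lia.
  by have := elimT (sortedP y) PM i; apply; rewrite sM; lia.
have forward i : p.-1 <= i -> i.+1 < n -> e (nth y L i) (nth y L i.+1).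
  move=> ip iN; have /(pathP y) /(_ (i - p.-1)) := Pt.
  rewrite size_rcons St => /(_ ltac:(lia)); congr (e _ _).
    rewrite /L -cat_cons nth_cat /= size_rev Ss ifF; last by lia.
    have -> : i - (p - 2).+1 = i - p.-1 by lia.
    rewrite -rcons_cons nth_rcons /= St ifT //; lia.
  rewrite /L -cat_cons nth_cat /= size_rev Ss ifF; last by lia.
  have -> : i.+1 - (p - 2).+1 = (i - p.-1).+1 by lia.
  rewrite /= nth_rcons St ifT //; lia.
have closing : e (nth y L n.-1) (nth y L 0).
  have := Pt; rewrite rcons_path => /andP [_].
  rewrite -[nth y L 0]/y -sL nth_last /L /= last_cat //.
move=> u v; rewrite -{2}(gK u) -{2}(gK v) /f.
move: (g u) (g v) => [i il] [j jl]; rewrite /Dnp /dicycle /=.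
case/orP=> /andP [ip /eqP E].
- case: (ltnP i.+1 n) => [iN|iN].
    by move: E; rewrite !modn_small // => <-; apply: forward.
  have -> : i = n.-1 by lia.
  have in1 : i.+1 = n by lia.
  by move: E; rewrite in1 modnn modn_small // => <-.
- case: (ltnP j.+1 n) => [jN|jN].
    by move: E; rewrite !modn_small // => <-; apply: backward.
  by lia.
Qed.

(** * Blow-ups of the 4-cycle *)

Definition blowup (T : Type) (e : rel T) (col : T -> nat) : Prop :=
  forall x y, e x y = (col y == col x + 1 %[mod 4]).

Section Blowup.
Variables (T : finType) (e : rel T) (col : T -> nat) (k : nat).
Hypotheses (bl : blowup e col) (reg : regular_digraph k.+1 e).

(** The out-neighbourhood of a vertex of colour [m] is the whole colour class [m + 1]. Going around
    the 4-cycle from the colour of [x0] reaches every class. *)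
Lemma card_color_class (x0 : T) n : #|[set y | col y == n %[mod 4]]| = k.+1.
Proof.
have step m : (exists x, col x == m %[mod 4]) ->
    #|[set y | col y == m + 1 %[mod 4]]| = k.+1.
  move=> [x /eqP Ex]; have [_ <-] := reg x.
  by apply: eq_card => y; rewrite !inE bl; lia.
have ex m : exists x, col x == col x0 + m %[mod 4].
  elim: m => [|m IH]; first by exists x0; rewrite addn0.
  have := step _ IH.
  have [->|[y]] := set_0Vmem [set y | col y == col x0 + m + 1 %[mod 4]].
    by rewrite cards0.
  by rewrite inE -addnA addn1 => Ey; exists y.
(* Modulo 4, [3 * col x0] cancels [col x0] and 3 stands for -1, so [x] has the colour before [n]. *)
have [x Ex] := ex (n + 3 + 3 * col x0).
rewrite -(step (n + 3)); last by exists x; move: Ex; lia.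
by apply: eq_card => y; rewrite !inE; lia.
Qed.

(** Number [x] goes to entry [x %/ 4] of the colour class of [x], so that each block
    [4q, .., 4q + 3] is a transversal 4-cycle. *)
Lemma blowup_enum (x0 : T) : exists g : nat -> T,
  [/\ forall x, x < 4 * k.+1 -> col (g x) == x %[mod 4],
      {in gtn (4 * k.+1) &, injective g} &
      forall v, exists2 x, x < 4 * k.+1 & g x = v].
Proof.
pose E n := enum [set y | col y == n %[mod 4]].
pose g x := nth x0 (E x) (x %/ 4).
have sE n : size (E n) = k.+1 by rewrite -cardE card_color_class.
have EE m n : m = n %[mod 4] -> E m = E n.
  by move=> mn; apply: eq_enum => y; rewrite !inE mn.
have colg x : x < 4 * k.+1 -> col (g x) == x %[mod 4].
  move=> xk; have: g x \in E x by apply: mem_nth; rewrite sE; lia.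
  by rewrite mem_enum inE.
exists g; split=> //.
  move=> x y; rewrite !inE => xk yk gxy.
  have xy : x = y %[mod 4].
    by have := colg _ xk; rewrite gxy => /eqP <-; apply/eqP/colg.
  move/eqP: gxy; rewrite /g (EE _ _ xy) nth_uniq ?sE ?enum_uniq //; lia.
move=> v; have vE : v \in E (col v) by rewrite mem_enum inE.
have := vE; rewrite -index_mem sE => iv.
exists (4 * index v (E (col v)) + col v %% 4); first by lia.
rewrite /g (EE _ (col v)); last by lia.
rewrite (_ : _ %/ 4 = index v (E (col v))); last by lia.
exact: nth_index.
Qed.

(** In the numbering of [blowup_enum], the arcs of the exceptional digraph are exactly the pairs
    whose difference is 1 modulo 4. *)
Lemma blowup_exceptional (x0 : T) : digraph_iso e (exceptional k.+1).
Proof.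
have [g [colg ginj gsurj]] := blowup_enum x0.
pose h (i : 'I_(4 * k.+1)) := g i.
have hi : injective h.
  by move=> i j /ginj; rewrite !inE !ltn_ord => /(_ isT isT) /val_inj.
have hb : bijective h.
  apply: inj_card_bij => //; rewrite -(card_codom hi) subset_leq_card //.
  apply/subsetP=> v _; have [x xk <-] := gsurj v.
  by apply/codomP; exists (Ordinal xk).
have [f hK fK] := hb; exists f; first by exists h.
move=> x y; rewrite -{2}(fK x) -{2}(fK y) bl.
move: (f x) (f y) => a b.
have -> : (col (h b) == col (h a) + 1 %[mod 4]) = (b == a + 1 %[mod 4]).
  have := colg _ (ltn_ord a); have := colg _ (ltn_ord b); rewrite /h; lia.
have [ak bk] := (ltn_ord a, ltn_ord b).
rewrite /exceptional /dicycle; apply/idP/idP.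
  case/orP=> [|/existsP [m /andP [_ /orP []]]].
  - move=> /eqP /(congr1 (modn^~ 4)); rewrite !modn_dvdm ?dvdn_mulr //.
    by move=> H; lia.
  - move=> /eqP /(congr1 (modn^~ 4)); rewrite !modn_dvdm ?dvdn_mulr //.
    by move=> H; lia.
  move=> /eqP /(congr1 (modn^~ 4)); rewrite !modn_dvdm ?dvdn_mulr //.
  by move=> H; lia.
move=> ba.
have [ab|ab] := leqP a b.
  pose m := (b - a) %/ 4; have mk : m < k.+1 by rewrite /m; lia.
  have bE : b = 4 * m + a + 1 :> nat by rewrite /m; lia.
  case: (posnP m) => m0.
    by rewrite bE m0 muln0 add0n addn1 eqxx.
  apply/orP; right; apply/existsP; exists (Ordinal mk) => /=.
  by rewrite m0 -bE eqxx orbT.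
(* The quotient exceeds the range of [m] only for the arc that closes the Hamiltonian cycle. *)
pose m := (a.+1 - b) %/ 4; have [km|mk] := leqP k.+1 m.
  have [-> ->] : a.+1 = 4 * k.+1 /\ nat_of_ord b = 0.
    by move: km; rewrite /m; lia.
  by rewrite modnn mod0n eqxx.
have aE : a.+1 = 4 * m + b :> nat by rewrite /m; lia.
case: (posnP m) => m0; first by move: aE; rewrite m0; lia.
apply/orP; right; apply/existsP; exists (Ordinal mk) => /=.
by rewrite m0 -aE eqxx.
Qed.

End Blowup.

(** * Types with respect to a 4-cycle *)

(** The vertex class is a boolean function here, since it then restricts to an induced digraph by
    composition with [val]. *)
Definition bipartition (T : Type) (e : rel T) (side : T -> bool) : Prop :=
  (forall x y, e x y -> side x != side y) /\
  (forall x y, side x != side y -> e x y = ~~ e y x).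

Lemma bipartite_tournament_side (T : finType) (e : rel T) :
  bipartite_tournament e -> exists side, bipartition e side.
Proof.
move=> [A [same diff]]; exists (fun x => x \in A); split=> x y.
  by move=> exy; apply: contraTneq exy => /same.
case: (boolP (x \in A)) (boolP (y \in A)) => [xA|xA] [yA|yA] // _.
  by have := diff _ _ xA yA; case: (e x y) (e y x) => [] [].
by have := diff _ _ yA xA; case: (e x y) (e y x) => [] [].
Qed.

Lemma bipartition_induced (T : finType) (e : rel T) side (S : {set T}) :
  bipartition e side -> bipartition (induced T e S) (side \o val).
Proof. by move=> [h1 h2]; split=> x y; [apply: h1|apply: h2]. Qed.

Lemma dicycle4_enum (T : finType) (e : rel T) :
  digraph_iso e (dicycle 4) -> exists c : nat -> T,
    [/\ forall i, c (i %% 4) = c i,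
        forall i j, e (c i) (c j) = (j == i + 1 %[mod 4]) &
        forall x, exists2 i, i < 4 & c i = x].
Proof.
move=> [f [g fK gK] fe]; exists (fun i => g (inord (i %% 4))); split.
- by move=> i; rewrite modn_mod.
- move=> i j; rewrite -fe !gK /dicycle !inordK ?ltn_pmod //; lia.
- by move=> x; exists (f x) => //; rewrite modn_small // inord_val fK.
Qed.

(** Starting the enumeration one step later if necessary makes sides agree with index parities, so
    that later facts about sides become arithmetic modulo 4. *)
Lemma dicycle4_enum_side (T : finType) (e : rel T) side :
  bipartition e side -> digraph_iso e (dicycle 4) -> exists c : nat -> T,
    [/\ forall i, c (i %% 4) = c i,
        forall i j, e (c i) (c j) = (j == i + 1 %[mod 4]),
        forall x, exists2 i, i < 4 & c i = x &
        forall i, side (c i) = odd i].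
Proof.
move=> [bip _] /dicycle4_enum [c0 [c0mod c0arc c0surj]].
pose d := nat_of_bool (side (c0 0)); pose c i := c0 (i + d).
have cmod i : c (i %% 4) = c i.
  by rewrite /c -(c0mod (i %% 4 + d)) modnDml c0mod.
have carc i j : e (c i) (c j) = (j == i + 1 %[mod 4]).
  by rewrite /c c0arc; lia.
exists c; split=> // [x|].
  have [i i4 Ei] := c0surj x.
  exists ((i + 4 - d) %% 4); first by rewrite ltn_pmod.
  rewrite cmod /c; have -> : i + 4 - d + d = i + 4 by rewrite /d; lia.
  by rewrite -c0mod modnDr c0mod Ei.
have step i : side (c i.+1) = ~~ side (c i).
  have := bip (c i) (c i.+1); rewrite carc addn1 eqxx => /(_ isT).
  by case: (side _) (side _) => [] [].
have side0 : side (c 0) = false.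
  have := c0arc 0 1; rewrite eqxx => /bip.
  by rewrite /c /d; case E: (side (c0 0)); rewrite ?E //; case: (side _).
by elim=> [|i IH]; rewrite ?step ?IH.
Qed.

Lemma decomposable_regular k (T : finType) (e : rel T) :
  decomposable_bt k.+1 e -> regular_digraph k.+1 e.
Proof.
case: k => [|k] /=; last by case.
move=> /dicycle4_enum [c [cmod carc csurj]] x.
have [i i4 <-] := csurj x; split.
  rewrite (_ : [set _ | _] = [set c (i + 3)]) ?cards1 //; apply/setP=> y.
  have [j j4 <-] := csurj y; rewrite !inE carc; apply/idP/eqP => [E|E].
    by rewrite -(cmod j) -(cmod (i + 3)); congr c; lia.
  by move: (carc j i); rewrite E carc => <-; lia.
rewrite (_ : [set _ | _] = [set c (i + 1)]) ?cards1 //; apply/setP=> y.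
have [j j4 <-] := csurj y; rewrite !inE carc; apply/idP/eqP => [E|E].
  by rewrite -(cmod j) -(cmod (i + 1)); congr c; lia.
by move: (carc i j); rewrite E carc => <-; lia.
Qed.

(* [ty v] is the position that v can take in the 4-cycle c: v has the same
   neighbours on c as [c (ty v)]. *)
Record framed (T : finType) (e : rel T) (side : T -> bool) (S : {set T})
    (c : nat -> T) (ty : T -> nat) : Prop := Framed {
  framed_in : forall i, c i \in S;
  framed_cover : forall x, x \in S -> exists2 i, i < 4 & c i = x;
  framed_mod : forall i, c (i %% 4) = c i;
  framed_ty : forall i, ty (c i) == i %[mod 4];
  framed_to : forall i v, e (c i) v = (ty v == i + 1 %[mod 4]);
  framed_from : forall i v, e v (c i) = (i == ty v + 1 %[mod 4]);
  framed_side : forall v, side v = odd (ty v) }.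

(** The type of [v] is one more than the position of its only in-neighbour on the cycle. The
    opposite cycle position lies on the same side, so it is the out-neighbour of [v]; the other two
    positions are not adjacent to [v]. *)
Lemma framed_of_indegree (T : finType) (e : rel T) side (S : {set T}) :
  bipartition e side -> digraph_iso (induced T e S) (dicycle 4) ->
  (forall v, v \notin S -> #|[set y in S | e y v]| = 1) ->
  exists c ty, framed e side S c ty.
Proof.
move=> bt /(dicycle4_enum_side (bipartition_induced _ bt)).
move=> [c0 [c0mod c0arc c0surj c0side]].
case: bt => bip tour indeg; pose c i := val (c0 i).
have cmod i : c (i %% 4) = c i by rewrite /c c0mod.
have carc i j : e (c i) (c j) = (j == i + 1 %[mod 4]) by apply: c0arc.
have cside i : side (c i) = odd i by apply: c0side.
have cS i : c i \in S by apply: valP.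
have csurj x : x \in S -> exists2 i, i < 4 & c i = x.
  by move=> xS; have [i i4 Ei] := c0surj (Sub x xS); exists i; rewrite // /c Ei.
(* The default value 4 of [find] never occurs, since [uniq_in] provides an in-neighbour among the
   four positions. *)
pose ty v := (find (fun i => e (c i) v) (iota 0 4)).+1.
have uniq_in v : exists i, forall j, e (c j) v = (j == i %[mod 4]).
  case: (boolP (v \in S)) => [/csurj [i _ <-]|/indeg /eqP /cards1P [w Ew]].
    by exists (i + 3) => j; rewrite carc; lia.
  have: w \in [set y in S | e y v] by rewrite Ew set11.
  rewrite inE => /andP [/csurj [i i4 Ei] _]; exists i => j.
  have: (c j \in [set y in S | e y v]) = (c j == w) by rewrite Ew inE.
  rewrite inE cS /= => ->; rewrite -Ei; apply/eqP/idP => [E|/eqP E].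
    by have := carc i (j + 1); rewrite -E carc; lia.
  by rewrite -(cmod i) -(cmod j) E.
have to_v i v : e (c i) v = (ty v == i + 1 %[mod 4]).
  rewrite /ty; have [j Ej] := uniq_in v; rewrite Ej.
  rewrite /= !Ej; have : j %% 4 < 4 by rewrite ltn_pmod.
  by move: (j %% 4) (@modn_mod j 4) => [|[|[|[|]]]] //=; lia.
have ty_side v : side v = odd (ty v).
  have e1 : e (c (ty v + 3)) v by rewrite to_v; lia.
  by have := bip _ _ e1; rewrite cside oddD; case: (side v) (odd _) => [] [].
exists c, ty; split=> //.
  by move=> i; have := to_v (i + 3) (c i); rewrite carc; lia.
move=> i v; case: (boolP (odd i == odd (ty v))) => oi.
  have -> : (i == ty v + 1 %[mod 4]) = false by lia.
  by apply: contraTF oi => /bip; rewrite cside ty_side eq_sym.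
by rewrite tour ?to_v ?cside ?ty_side; lia.
Qed.

(** A vertex outside [S] has in-degree [k + 2] in total and [k + 1] within the complement of [S],
    which leaves one in-neighbour in [S]. *)
Lemma decomposable_framed k (T : finType) (e : rel T) side :
  bipartition e side -> decomposable_bt k.+2 e ->
  exists S c ty,
    framed e side S c ty /\ decomposable_bt k.+1 (induced T e (~: S)).
Proof.
move=> bip [_ reg [S [isoS dec]]]; exists S.
suff [c [ty fr]] : exists c ty, framed e side S c ty by exists c, ty.
apply: framed_of_indegree => // v vS.
have [inT _] := reg v.
have vS' : v \in ~: S by rewrite inE.
have [inS _] := decomposable_regular dec (Sub v vS').
have := cardsID S [set y | e y v]; rewrite inT.
have -> : [set y | e y v] :\: S =
    [set val y | y in [set y | induced T e (~: S) y (Sub v vS')]].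
  apply/setP=> y; rewrite !inE; apply/andP/imsetP => [[yS eyv]|[z]].
    have yS' : y \in ~: S by rewrite inE.
    by exists (Sub y yS'); rewrite ?inE.
  by rewrite inE => ezv ->; split=> //; have := valP z; rewrite inE.
rewrite card_imset; last exact: val_inj.
by rewrite inS setIC setIdE; lia.
Qed.

(** * Paths rerouted through additional vertices *)

Definition absorbs (T : eqType) (e : rel T) x p (R : seq T) : Prop :=
  exists p', [/\ perm_eq p' (p ++ R), path e x p' & last x p' = last x p].

Lemma framed_absorbs (T : finType) (e : rel T) side S c ty x p :
  bipartition e side -> framed e side S c ty ->
  path e x p -> 3 <= size p -> absorbs e x p [:: c 0; c 1; c 2; c 3].
Proof.
move=> [bip _] fr; case: p => [|v1 [|v2 [|v3 p]]] //= /and4P [e1 e2 e3 ep] _.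
have arc i : e (c i) (c (i + 1)).
  by rewrite (framed_to fr); have := framed_ty fr (i + 1); lia.
(* One full turn of the cycle, entered just after position [n] and left at [n + 4], which is again
   position [n]. *)
pose D n := [:: c (n + 1); c (n + 2); c (n + 3); c (n + 4)].
have pD n : perm_eq (D n) [:: c 0; c 1; c 2; c 3].
  suff -> : D n = rot ((n + 1) %% 4) [:: c 0; c 1; c 2; c 3].
    by rewrite perm_rot.
  rewrite /D -(framed_mod fr (n + 1)) -(framed_mod fr (n + 2)).
  rewrite -(framed_mod fr (n + 3)) -(framed_mod fr (n + 4)).
  have: n %% 4 < 4 by rewrite ltn_pmod.
  rewrite -(modnDml n 1) -(modnDml n 2) -(modnDml n 3) -(modnDml n 4).
  by case: (n %% 4) => [|[|[|[|]]]].
have whole u v q : e u v -> ty v == ty u + 1 %[mod 4] -> path e v q ->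
    path e u (D (ty u) ++ v :: q).
  move=> euv E pq /=; rewrite pq andbT (framed_from fr) eqxx /=.
  rewrite (framed_to fr (ty u + 4)); apply/and4P; split; try lia.
  - by have := arc (ty u + 1); rewrite -addnA.
  - by have := arc (ty u + 2); rewrite -addnA.
  - by have := arc (ty u + 3); rewrite -addnA.
have types u v : e u v ->
    ty v == ty u + 1 %[mod 4] \/ ty v == ty u + 3 %[mod 4].
  by move=> /bip; rewrite !(framed_side fr); lia.
have perm_D n s1 s2 :
    perm_eq (s1 ++ D n ++ s2) ((s1 ++ s2) ++ [:: c 0; c 1; c 2; c 3]).
  by rewrite -catA perm_cat2l perm_catC perm_cat2l.
have [g1|b1] := types _ _ e1.
  exists (D (ty x) ++ v1 :: v2 :: v3 :: p); split.
  - exact: (perm_D _ [::]).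
  - by apply: whole => //=; rewrite e2 e3.
  - by rewrite last_cat.
have [g2|b2] := types _ _ e2.
  exists (v1 :: D (ty v1) ++ v2 :: v3 :: p); split.
  - exact: (perm_D _ [:: v1]).
  - by rewrite /= e1; apply: (whole v1 v2 (v3 :: p)) => //=; rewrite e3.
  - by [].
have [g3|b3] := types _ _ e3.
  exists (v1 :: v2 :: D (ty v2) ++ v3 :: p); split.
  - exact: (perm_D _ [:: v1; v2]).
  - by rewrite /= e1 e2; apply: (whole v2 v3 p).
  - by [].
(* All three arcs lower the type by 1, so [x], [v1], [v2], [v3] have types [t], [t + 3], [t + 2],
   [t + 1]. Half of the cycle fits between [x] and [v1], the other half between [v2] and [v3]. *)
pose t := ty x.
exists [:: c (t + 1), c (t + 2), v1, v2, c (t + 3), c (t + 4), v3 & p].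
split=> //.
- apply: perm_trans (perm_D t [:: v1; v2] (v3 :: p)).
  by have := permEl (perm_catCA [:: c (t + 1); c (t + 2)] [:: v1; v2]
    [:: c (t + 3), c (t + 4), v3 & p]).
- have a1 := arc (t + 1); have a3 := arc (t + 3); rewrite -!addnA in a1 a3.
  rewrite /= a1 a3 ep e2 !(framed_from fr) !(framed_to fr) /t.
  by rewrite !andbT /=; apply/and4P; split; lia.
Qed.

(** * Twelve-vertex tournaments *)

(** The layer pairs 01, 02, 12 have sums 1, 2, 3 and so own the bits 0-3, 4-7, 8-11. The larger
    vertex lies in the later layer, and its residue selects the bit. *)
Definition flip_index (x y : nat) : nat :=
  4 * (x %/ 4 + y %/ 4).-1 + maxn x y %% 4.

Definition flipped (bs : bitseq) (x y : nat) : bool :=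
  (x %/ 4 != y %/ 4) && nth false bs (flip_index x y).

(* Three 4-cycles on {0,..,3}, {4,..,7} and {8,..,11}, the earlier ones framing
   the later ones; the 12 bits of bs, indexed by [flip_index], tell which inner
   vertices x have type x + 2 rather than x with respect to an outer cycle. *)
Definition arc12 (bs : bitseq) : rel nat := fun x y =>
  y == x + 1 + 2 * flipped bs x y %[mod 4].

(** These bits yield blow-ups: layers 1 and 2 are shifted by [2a] and [2b] against layer 0, hence by
    twice the exclusive or against each other. *)
Definition exceptional_bits (a b : bool) : bitseq :=
  nseq 4 a ++ nseq 4 b ++ nseq 4 (a (+) b).

Definition arcs_of (s : seq nat) : seq (nat * nat) := zip s (behead s).

Definition has_inner_arc (s : seq nat) : bool :=
  has (fun a => (4 <= a.1) && (4 <= a.2)) (arcs_of s).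

(** Inner arcs avoid the outer cycle {0,..,3}. They are the arcs of the blow-up, where further
    transversals can be inserted into the path. *)
Definition theta12 (bs : bitseq) (i : nat) : Prop :=
  exists x y s t,
    [/\ perm_eq (x :: y :: s ++ t) (iota 0 12), size s = i,
        path (arc12 bs) x (rcons s y) /\ path (arc12 bs) x (rcons t y),
        has_inner_arc (x :: rcons t y) &
        2 <= i -> has_inner_arc (x :: rcons s y)].

(* A row [x :: s ++ y :: t] with [size s = i] encodes the paths from x to y
   through s and through t. *)
Definition first_path (i : nat) (w : seq nat) : seq nat := take i.+2 w.

Definition second_path (i : nat) (w : seq nat) : seq nat :=
  rcons (head 0 w :: drop i.+2 w) (nth 0 w i.+1).

Definition witness_arcs (i : nat) (w : seq nat) : seq (nat * nat) :=
  arcs_of (first_path i w) ++ arcs_of (second_path i w).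

(** The bit values that make the arcs present. An arc inside a layer imposes no condition. *)
Definition literals (w : seq (nat * nat)) : seq (nat * bool) :=
  [seq (flip_index a.1 a.2, a.2 != a.1 + 1 %[mod 4]) |
    a <- w & a.1 %/ 4 != a.2 %/ 4].

(** [None] marks a free bit. If the literals contradict each other, [true] wins; [valid_witness]
    rejects such rows. *)
Definition cube (ls : seq (nat * bool)) : seq (option bool) :=
  mkseq (fun n => if (n, true) \in ls then Some true
                  else if (n, false) \in ls then Some false else None) 12.

Definition in_cube (c : seq (option bool)) (bs : bitseq) : bool :=
  all2 (fun o b => oapp (eq_op b) true o) c bs.

Definition half_cube (b : bool) (cs : seq (seq (option bool))) :=
  [seq behead c | c <- cs & head None c != Some (~~ b)].

(** Case split on the leading bit, keeping only the compatible cubes; at a leaf some cube must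
    survive. *)
Fixpoint covers (n : nat) (cs : seq (seq (option bool))) : bool :=
  if n is m.+1
  then covers m (half_cube true cs) && covers m (half_cube false cs)
  else cs != [::].

(** The parity test matters because a literal records only whether [a.2] is [a.1 + 1] modulo 4; for
    opposite parities the alternative is [a.1 + 3]. *)
Definition valid_witness (i : nat) (w : seq nat) : bool :=
  let ls := literals (witness_arcs i w) in
  [&& size w == 12, all (gtn 12) w, uniq w,
      all (fun a => (odd a.1 != odd a.2) && ((a.1 %/ 4 != a.2 %/ 4) ||
             (a.2 == a.1 + 1 %[mod 4]))) (witness_arcs i w),
      all (fun l => nth None (cube ls) l.1 == Some l.2) ls,
      has_inner_arc (second_path i w) &
      (2 <= i) ==> has_inner_arc (first_path i w)].

(* Found by computer search: the i-th entry lists rows with [size s = i] whose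
   cubes cover all bit sequences other than the four exceptional ones. *)
Definition witnesses : seq (seq (seq nat)) :=
  [::
    [:: [:: 0; 7; 1; 2; 3; 8; 9; 10; 11; 4; 5; 6];
      [:: 1; 2; 6; 3; 0; 7; 4; 5; 10; 11; 8; 9];
      [:: 1; 8; 2; 3; 0; 5; 6; 7; 4; 9; 10; 11];
      [:: 1; 10; 2; 3; 0; 5; 6; 7; 4; 11; 8; 9];
      [:: 2; 3; 11; 0; 1; 8; 9; 10; 5; 6; 7; 4];
      [:: 2; 7; 3; 0; 1; 8; 9; 10; 11; 4; 5; 6];
      [:: 3; 8; 0; 1; 2; 7; 4; 5; 6; 9; 10; 11];
      [:: 4; 9; 5; 6; 7; 0; 1; 2; 3; 10; 11; 8];
      [:: 5; 8; 6; 7; 4; 1; 2; 3; 0; 9; 10; 11];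
      [:: 5; 10; 6; 7; 4; 3; 0; 1; 2; 11; 8; 9];
      [:: 7; 2; 4; 5; 6; 9; 10; 11; 8; 3; 0; 1];
      [:: 7; 4; 10; 11; 8; 9; 0; 1; 2; 5; 6; 3];
      [:: 7; 8; 4; 5; 6; 1; 2; 3; 0; 9; 10; 11];
      [:: 7; 10; 4; 5; 6; 3; 0; 1; 2; 11; 8; 9];
      [:: 8; 5; 9; 10; 11; 2; 3; 0; 1; 6; 7; 4];
      [:: 8; 7; 9; 10; 11; 2; 3; 0; 1; 4; 5; 6];
      [:: 8; 9; 3; 0; 1; 2; 7; 4; 5; 10; 11; 6];
      [:: 8; 9; 5; 6; 7; 4; 3; 0; 1; 10; 11; 2];
      [:: 10; 3; 11; 8; 9; 6; 7; 4; 5; 0; 1; 2];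
      [:: 10; 5; 11; 8; 9; 0; 1; 2; 3; 6; 7; 4];
      [:: 10; 7; 11; 8; 9; 0; 1; 2; 3; 4; 5; 6];
      [:: 10; 11; 3; 0; 1; 2; 7; 4; 5; 8; 9; 6];
      [:: 11; 6; 8; 9; 10; 1; 2; 3; 0; 7; 4; 5]];
    [:: [:: 0; 1; 2; 7; 4; 5; 6; 3; 8; 9; 10; 11];
      [:: 0; 1; 2; 9; 10; 11; 8; 3; 6; 7; 4; 5];
      [:: 0; 1; 6; 7; 2; 3; 10; 11; 8; 9; 4; 5];
      [:: 0; 1; 6; 11; 2; 3; 4; 5; 10; 7; 8; 9];
      [:: 0; 1; 8; 9; 2; 3; 4; 5; 6; 7; 10; 11];
      [:: 0; 7; 4; 1; 2; 3; 8; 9; 10; 5; 6; 11];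
      [:: 0; 7; 4; 1; 2; 3; 10; 11; 8; 5; 6; 9];
      [:: 1; 2; 5; 6; 3; 0; 11; 8; 9; 10; 7; 4];
      [:: 1; 2; 5; 10; 3; 0; 9; 4; 11; 6; 7; 8];
      [:: 1; 2; 7; 4; 3; 0; 9; 10; 11; 8; 5; 6];
      [:: 1; 2; 7; 4; 3; 0; 11; 8; 9; 10; 5; 6];
      [:: 1; 2; 7; 8; 3; 0; 9; 10; 11; 4; 5; 6];
      [:: 1; 2; 9; 6; 3; 0; 5; 10; 7; 4; 11; 8];
      [:: 1; 2; 11; 6; 3; 0; 7; 4; 5; 8; 9; 10];
      [:: 1; 4; 5; 2; 3; 0; 11; 8; 9; 6; 7; 10];
      [:: 1; 8; 7; 4; 5; 6; 9; 10; 11; 2; 3; 0];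
      [:: 2; 3; 0; 11; 8; 1; 4; 9; 6; 7; 10; 5];
      [:: 2; 3; 0; 11; 8; 9; 4; 1; 10; 5; 6; 7];
      [:: 2; 3; 6; 9; 0; 1; 10; 11; 8; 7; 4; 5];
      [:: 2; 5; 0; 3; 4; 1; 6; 7; 8; 9; 10; 11];
      [:: 2; 5; 0; 3; 4; 1; 8; 9; 10; 11; 6; 7];
      [:: 2; 7; 0; 3; 6; 1; 4; 5; 10; 11; 8; 9];
      [:: 3; 0; 1; 4; 11; 6; 7; 8; 5; 2; 9; 10];
      [:: 3; 0; 1; 10; 11; 4; 5; 8; 7; 2; 9; 6];
      [:: 3; 0; 5; 6; 1; 2; 9; 10; 11; 8; 7; 4];
      [:: 3; 0; 7; 4; 1; 2; 5; 8; 9; 10; 11; 6];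
      [:: 3; 0; 7; 4; 1; 2; 9; 10; 11; 8; 5; 6];
      [:: 3; 0; 9; 6; 1; 2; 7; 4; 5; 10; 11; 8];
      [:: 3; 0; 11; 8; 1; 2; 7; 4; 5; 6; 9; 10];
      [:: 3; 4; 5; 0; 1; 2; 11; 8; 9; 6; 7; 10];
      [:: 3; 4; 5; 6; 7; 0; 1; 2; 9; 10; 11; 8];
      [:: 4; 3; 0; 5; 6; 7; 8; 9; 10; 1; 2; 11];
      [:: 4; 5; 2; 9; 10; 11; 8; 3; 0; 1; 6; 7];
      [:: 4; 5; 6; 9; 10; 11; 0; 7; 2; 3; 8; 1];
      [:: 4; 5; 8; 9; 6; 7; 0; 1; 2; 3; 10; 11];
      [:: 4; 5; 10; 11; 6; 7; 0; 1; 2; 3; 8; 9];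
      [:: 5; 6; 3; 8; 7; 4; 1; 2; 11; 0; 9; 10];
      [:: 5; 6; 3; 8; 9; 10; 11; 0; 1; 2; 7; 4];
      [:: 5; 6; 7; 0; 1; 2; 3; 4; 11; 8; 9; 10];
      [:: 5; 6; 9; 10; 7; 4; 1; 2; 3; 0; 11; 8];
      [:: 5; 8; 9; 6; 7; 4; 3; 10; 11; 0; 1; 2];
      [:: 5; 10; 11; 6; 7; 0; 1; 8; 9; 2; 3; 4];
      [:: 5; 10; 11; 6; 7; 4; 3; 8; 1; 2; 9; 0];
      [:: 6; 1; 2; 7; 4; 9; 10; 11; 8; 3; 0; 5];
      [:: 6; 1; 2; 7; 4; 11; 8; 9; 10; 3; 0; 5];
      [:: 6; 7; 4; 9; 10; 3; 0; 11; 2; 5; 8; 1];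
      [:: 6; 7; 4; 11; 8; 9; 10; 5; 0; 1; 2; 3];
      [:: 6; 7; 8; 9; 4; 5; 2; 3; 0; 1; 10; 11];
      [:: 6; 11; 8; 7; 4; 5; 2; 9; 10; 3; 0; 1];
      [:: 7; 8; 5; 4; 9; 6; 1; 10; 3; 0; 11; 2];
      [:: 8; 3; 0; 9; 10; 1; 6; 7; 4; 5; 2; 11];
      [:: 8; 3; 0; 9; 10; 1; 6; 11; 4; 5; 2; 7];
      [:: 8; 7; 4; 9; 10; 3; 0; 1; 2; 5; 6; 11];
      [:: 8; 9; 10; 5; 0; 1; 4; 11; 6; 7; 2; 3];
      [:: 8; 9; 10; 5; 6; 7; 2; 11; 4; 3; 0; 1];
      [:: 8; 9; 10; 5; 6; 7; 4; 11; 2; 3; 0; 1];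
      [:: 8; 9; 10; 7; 4; 5; 6; 11; 0; 1; 2; 3];
      [:: 9; 2; 3; 10; 11; 6; 7; 4; 5; 0; 1; 8];
      [:: 9; 10; 1; 2; 3; 0; 7; 4; 5; 6; 11; 8];
      [:: 9; 10; 3; 0; 1; 2; 11; 8; 5; 6; 7; 4];
      [:: 9; 10; 5; 6; 7; 4; 1; 2; 3; 0; 11; 8];
      [:: 9; 10; 11; 0; 1; 2; 5; 8; 3; 6; 7; 4];
      [:: 9; 10; 11; 6; 7; 4; 5; 8; 1; 2; 3; 0];
      [:: 10; 11; 0; 1; 2; 3; 8; 9; 4; 5; 6; 7];
      [:: 10; 11; 0; 5; 6; 1; 4; 3; 8; 9; 2; 7];
      [:: 10; 11; 2; 3; 0; 1; 8; 9; 4; 5; 6; 7];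
      [:: 10; 11; 8; 7; 4; 5; 0; 9; 2; 3; 6; 1];
      [:: 10; 11; 8; 7; 4; 5; 2; 9; 0; 1; 6; 3];
      [:: 11; 4; 5; 8; 9; 2; 3; 10; 1; 6; 7; 0];
      [:: 11; 6; 7; 8; 9; 2; 3; 0; 1; 4; 5; 10];
      [:: 11; 8; 1; 6; 7; 4; 5; 2; 3; 0; 9; 10];
      [:: 11; 8; 7; 6; 9; 4; 3; 10; 1; 2; 5; 0];
      [:: 11; 8; 9; 4; 5; 6; 1; 10; 7; 2; 3; 0];
      [:: 11; 8; 9; 6; 7; 4; 1; 10; 3; 0; 5; 2]];
    [:: [:: 0; 1; 8; 9; 7; 2; 3; 10; 5; 6; 11; 4];
      [:: 1; 2; 7; 4; 8; 3; 10; 11; 0; 5; 6; 9];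
      [:: 2; 3; 8; 9; 7; 0; 1; 10; 5; 6; 11; 4];
      [:: 2; 3; 10; 11; 7; 0; 1; 8; 5; 6; 9; 4];
      [:: 4; 5; 6; 7; 1; 2; 3; 0; 9; 10; 11; 8];
      [:: 4; 5; 6; 7; 3; 0; 1; 2; 11; 8; 9; 10];
      [:: 4; 5; 6; 7; 9; 10; 1; 2; 11; 8; 3; 0];
      [:: 4; 5; 6; 7; 11; 8; 9; 10; 1; 2; 3; 0];
      [:: 5; 6; 7; 4; 2; 3; 0; 1; 8; 9; 10; 11];
      [:: 6; 7; 4; 5; 1; 2; 3; 0; 9; 10; 11; 8];
      [:: 6; 7; 4; 5; 9; 10; 11; 8; 3; 0; 1; 2];
      [:: 6; 7; 4; 5; 11; 8; 1; 2; 9; 10; 3; 0];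
      [:: 7; 4; 5; 0; 2; 3; 8; 1; 10; 11; 6; 9];
      [:: 7; 4; 5; 6; 0; 1; 2; 3; 10; 11; 8; 9];
      [:: 8; 9; 10; 11; 1; 2; 3; 0; 7; 4; 5; 6];
      [:: 8; 9; 10; 11; 7; 4; 5; 6; 1; 2; 3; 0];
      [:: 9; 10; 11; 8; 4; 5; 0; 1; 6; 7; 2; 3];
      [:: 9; 10; 11; 8; 4; 5; 6; 7; 0; 1; 2; 3];
      [:: 9; 10; 11; 8; 6; 7; 2; 3; 4; 5; 0; 1];
      [:: 10; 11; 8; 9; 1; 2; 3; 0; 7; 4; 5; 6];
      [:: 10; 11; 8; 9; 1; 2; 7; 4; 3; 0; 5; 6];
      [:: 10; 11; 8; 9; 3; 0; 1; 2; 5; 6; 7; 4];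
      [:: 11; 8; 9; 10; 2; 3; 0; 1; 6; 7; 4; 5];
      [:: 11; 8; 9; 10; 6; 7; 4; 5; 2; 3; 0; 1]];
    [:: [:: 0; 9; 2; 11; 8; 1; 6; 7; 10; 3; 4; 5];
      [:: 1; 4; 5; 6; 7; 2; 3; 0; 11; 8; 9; 10];
      [:: 1; 6; 3; 4; 5; 2; 9; 10; 7; 0; 11; 8];
      [:: 3; 6; 1; 4; 5; 0; 9; 10; 7; 2; 11; 8];
      [:: 4; 5; 6; 7; 10; 1; 2; 3; 0; 11; 8; 9];
      [:: 5; 6; 7; 4; 1; 10; 11; 8; 9; 2; 3; 0];
      [:: 6; 7; 4; 5; 8; 3; 0; 1; 2; 9; 10; 11];
      [:: 7; 4; 3; 6; 1; 10; 11; 2; 5; 8; 9; 0];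
      [:: 7; 4; 5; 6; 3; 8; 9; 10; 11; 0; 1; 2];
      [:: 8; 7; 4; 5; 6; 9; 2; 3; 10; 11; 0; 1];
      [:: 8; 9; 10; 11; 2; 5; 6; 7; 4; 3; 0; 1];
      [:: 8; 9; 10; 11; 2; 7; 4; 3; 0; 5; 6; 1];
      [:: 9; 10; 11; 8; 5; 0; 1; 6; 7; 2; 3; 4];
      [:: 9; 10; 11; 8; 5; 2; 3; 6; 7; 0; 1; 4];
      [:: 9; 10; 11; 8; 7; 2; 3; 0; 1; 4; 5; 6];
      [:: 10; 11; 8; 9; 0; 7; 4; 5; 6; 1; 2; 3];
      [:: 11; 8; 9; 10; 5; 0; 1; 2; 3; 6; 7; 4]];
    [:: [:: 0; 5; 2; 3; 8; 7; 1; 10; 11; 4; 9; 6];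
      [:: 0; 7; 4; 5; 6; 11; 1; 2; 3; 8; 9; 10];
      [:: 1; 4; 5; 6; 7; 8; 2; 3; 0; 9; 10; 11];
      [:: 1; 4; 5; 6; 7; 10; 2; 3; 0; 11; 8; 9];
      [:: 1; 8; 9; 10; 11; 4; 2; 3; 0; 5; 6; 7];
      [:: 2; 3; 0; 1; 8; 9; 7; 4; 5; 10; 11; 6];
      [:: 2; 11; 6; 7; 4; 5; 3; 0; 1; 8; 9; 10];
      [:: 2; 11; 8; 9; 10; 5; 3; 0; 1; 6; 7; 4];
      [:: 3; 0; 1; 2; 11; 8; 6; 7; 4; 9; 10; 5];
      [:: 3; 10; 11; 8; 9; 4; 0; 1; 2; 5; 6; 7];
      [:: 3; 10; 11; 8; 9; 6; 0; 1; 2; 7; 4; 5];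
      [:: 4; 5; 6; 7; 2; 3; 9; 10; 11; 0; 1; 8];
      [:: 4; 5; 6; 7; 2; 3; 11; 8; 9; 0; 1; 10];
      [:: 4; 11; 8; 9; 10; 1; 5; 6; 7; 2; 3; 0];
      [:: 4; 11; 8; 9; 10; 3; 5; 6; 7; 0; 1; 2];
      [:: 6; 7; 4; 9; 10; 1; 11; 2; 5; 8; 3; 0];
      [:: 6; 11; 8; 9; 10; 3; 7; 4; 5; 0; 1; 2];
      [:: 8; 5; 6; 7; 4; 1; 9; 10; 11; 2; 3; 0];
      [:: 8; 9; 10; 11; 0; 5; 1; 2; 3; 6; 7; 4];
      [:: 9; 4; 5; 6; 7; 0; 10; 11; 8; 1; 2; 3];
      [:: 9; 10; 11; 8; 1; 2; 6; 7; 4; 3; 0; 5];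
      [:: 10; 5; 6; 7; 4; 1; 11; 8; 9; 2; 3; 0];
      [:: 10; 7; 4; 5; 6; 3; 11; 8; 9; 0; 1; 2];
      [:: 10; 11; 8; 9; 0; 1; 5; 2; 3; 6; 7; 4];
      [:: 11; 6; 7; 4; 5; 10; 8; 9; 2; 3; 0; 1]];
    [:: [:: 0; 1; 2; 3; 4; 5; 6; 7; 8; 9; 10; 11];
      [:: 0; 1; 6; 7; 4; 5; 8; 9; 2; 3; 10; 11];
      [:: 0; 1; 6; 7; 4; 5; 10; 11; 2; 3; 8; 9];
      [:: 0; 1; 10; 11; 8; 9; 6; 7; 2; 3; 4; 5];
      [:: 1; 2; 3; 0; 5; 6; 7; 4; 11; 8; 9; 10];
      [:: 1; 2; 3; 0; 5; 8; 7; 10; 11; 4; 9; 6];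
      [:: 1; 2; 3; 0; 5; 8; 9; 10; 11; 6; 7; 4];
      [:: 1; 2; 3; 0; 5; 10; 7; 8; 9; 4; 11; 6];
      [:: 1; 2; 3; 0; 9; 10; 11; 8; 7; 4; 5; 6];
      [:: 1; 2; 3; 6; 7; 10; 5; 8; 9; 0; 11; 4];
      [:: 1; 4; 3; 0; 5; 6; 7; 2; 11; 8; 9; 10];
      [:: 1; 8; 3; 0; 9; 10; 11; 2; 7; 4; 5; 6];
      [:: 1; 10; 3; 0; 11; 8; 9; 2; 7; 4; 5; 6];
      [:: 2; 3; 0; 1; 6; 7; 4; 5; 10; 11; 8; 9];
      [:: 2; 3; 0; 1; 6; 9; 4; 7; 8; 5; 10; 11];
      [:: 2; 9; 0; 1; 10; 11; 8; 3; 6; 7; 4; 5];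
      [:: 3; 0; 1; 2; 9; 10; 7; 6; 11; 4; 5; 8];
      [:: 3; 0; 1; 4; 5; 10; 7; 6; 9; 2; 11; 8];
      [:: 3; 0; 5; 6; 7; 4; 9; 10; 1; 2; 11; 8];
      [:: 3; 0; 11; 6; 7; 4; 5; 8; 1; 2; 9; 10];
      [:: 3; 6; 1; 2; 7; 4; 5; 0; 11; 8; 9; 10];
      [:: 4; 5; 2; 3; 0; 1; 8; 9; 6; 7; 10; 11];
      [:: 4; 5; 2; 3; 0; 1; 10; 11; 6; 7; 8; 9];
      [:: 4; 5; 6; 1; 2; 7; 0; 9; 10; 11; 8; 3];
      [:: 4; 5; 6; 3; 0; 7; 2; 1; 8; 9; 10; 11];
      [:: 4; 5; 6; 7; 8; 9; 0; 1; 2; 3; 10; 11];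
      [:: 4; 5; 6; 7; 10; 11; 2; 3; 0; 1; 8; 9];
      [:: 4; 11; 8; 5; 6; 7; 10; 3; 0; 1; 2; 9];
      [:: 4; 11; 8; 9; 10; 3; 0; 5; 6; 1; 2; 7];
      [:: 5; 6; 7; 2; 3; 0; 1; 10; 11; 8; 9; 4];
      [:: 5; 6; 7; 2; 3; 4; 1; 0; 9; 10; 11; 8];
      [:: 5; 6; 7; 4; 9; 10; 11; 8; 1; 2; 3; 0];
      [:: 5; 6; 7; 4; 11; 8; 1; 2; 3; 0; 9; 10];
      [:: 5; 6; 7; 10; 11; 2; 3; 8; 9; 0; 1; 4];
      [:: 6; 7; 0; 1; 2; 3; 10; 11; 4; 5; 8; 9];
      [:: 6; 7; 2; 3; 0; 1; 10; 11; 4; 5; 8; 9];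
      [:: 6; 7; 4; 3; 0; 5; 2; 9; 10; 11; 8; 1];
      [:: 6; 7; 4; 3; 0; 5; 2; 11; 8; 9; 10; 1];
      [:: 6; 7; 4; 5; 0; 9; 10; 11; 8; 1; 2; 3];
      [:: 6; 7; 4; 5; 2; 3; 0; 1; 10; 11; 8; 9];
      [:: 6; 7; 4; 5; 8; 9; 0; 1; 2; 3; 10; 11];
      [:: 6; 7; 4; 5; 10; 11; 2; 3; 0; 1; 8; 9];
      [:: 6; 7; 4; 9; 10; 3; 0; 11; 8; 1; 2; 5];
      [:: 6; 7; 8; 5; 0; 1; 2; 9; 4; 3; 10; 11];
      [:: 7; 0; 5; 2; 11; 4; 1; 8; 9; 10; 3; 6];
      [:: 7; 2; 3; 0; 11; 6; 1; 4; 5; 8; 9; 10];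
      [:: 7; 4; 1; 2; 3; 0; 9; 10; 5; 6; 11; 8];
      [:: 7; 4; 5; 0; 1; 2; 3; 8; 9; 10; 11; 6];
      [:: 7; 4; 5; 0; 1; 6; 3; 10; 11; 8; 9; 2];
      [:: 7; 4; 5; 6; 9; 2; 3; 10; 11; 0; 1; 8];
      [:: 7; 4; 5; 8; 9; 0; 1; 10; 11; 2; 3; 6];
      [:: 7; 4; 5; 10; 11; 8; 3; 0; 1; 2; 9; 6];
      [:: 7; 4; 11; 6; 1; 10; 3; 8; 5; 0; 9; 2];
      [:: 8; 9; 10; 1; 2; 11; 0; 5; 6; 7; 4; 3];
      [:: 8; 9; 10; 1; 2; 11; 0; 7; 4; 5; 6; 3];
      [:: 8; 9; 10; 3; 0; 1; 4; 5; 6; 7; 2; 11];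
      [:: 8; 9; 10; 3; 0; 11; 2; 7; 4; 5; 6; 1];
      [:: 8; 9; 10; 5; 6; 7; 4; 1; 2; 3; 0; 11];
      [:: 8; 9; 10; 7; 4; 11; 6; 5; 0; 1; 2; 3];
      [:: 8; 9; 10; 11; 6; 3; 0; 7; 4; 1; 2; 5];
      [:: 9; 2; 3; 0; 5; 6; 7; 4; 1; 10; 11; 8];
      [:: 9; 10; 11; 2; 3; 4; 5; 0; 1; 6; 7; 8];
      [:: 9; 10; 11; 2; 3; 8; 1; 6; 7; 4; 5; 0];
      [:: 9; 10; 11; 8; 5; 0; 1; 6; 7; 2; 3; 4];
      [:: 10; 11; 8; 3; 0; 1; 2; 5; 6; 7; 4; 9];
      [:: 10; 11; 8; 5; 2; 9; 0; 7; 4; 1; 6; 3];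
      [:: 10; 11; 8; 5; 6; 1; 2; 7; 4; 3; 0; 9];
      [:: 10; 11; 8; 5; 6; 7; 4; 1; 2; 3; 0; 9];
      [:: 10; 11; 8; 7; 4; 9; 6; 3; 0; 1; 2; 5];
      [:: 10; 11; 8; 9; 4; 5; 6; 7; 0; 1; 2; 3];
      [:: 11; 4; 5; 6; 7; 2; 3; 8; 9; 0; 1; 10];
      [:: 11; 6; 7; 4; 5; 0; 1; 8; 9; 2; 3; 10];
      [:: 11; 8; 7; 4; 5; 6; 3; 0; 1; 2; 9; 10];
      [:: 11; 8; 9; 0; 1; 2; 3; 4; 5; 6; 7; 10];
      [:: 11; 8; 9; 10; 1; 6; 3; 2; 5; 0; 7; 4];
      [:: 11; 8; 9; 10; 5; 6; 7; 4; 3; 0; 1; 2];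
      [:: 11; 8; 9; 10; 7; 4; 1; 2; 3; 0; 5; 6]]
  ].


(** Cubes without free bits. Joined to the cubes of the witnesses, they let one covering test show
    that the witnesses catch every other bit sequence. *)
Definition exceptional_cubes : seq (seq (option bool)) :=
  [seq [seq Some c | c <- exceptional_bits a b] |
    a <- [:: false; true], b <- [:: false; true]].

Definition witnesses_ok (i : nat) : bool :=
  let ws := nth [::] witnesses i in
  all (valid_witness i) ws &&
  covers 12 (exceptional_cubes ++
             [seq cube (literals (witness_arcs i w)) | w <- ws]).

(** Sizes up to 5 suffice: the two paths share 10 interior vertices, and the shorter path can be
    taken first. *)
Lemma all_witnesses_ok : all witnesses_ok (iota 0 6).
Proof. by vm_compute. Qed.

Lemma covers_in_cube n cs bs :
  size bs = n -> covers n cs -> all (fun c => size c == n) cs ->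
  exists2 c, c \in cs & in_cube c bs.
Proof.
elim: n cs bs => [|n IH] cs [|b bs] //= => [_|[sbs]].
  case: cs => //= c cs _ /andP [/nilP -> _]; exists [::] => //.
move=> cov sz; have cov' : covers n (half_cube b cs).
  by case/andP: cov; case: b.
have sz' : all (fun c => size c == n) (half_cube b cs).
  apply/allP=> d /mapP [c]; rewrite mem_filter.
  move=> /andP [_ /(allP sz) /eqP sc] ->.
  by rewrite size_behead sc.
have [_ /mapP [c + ->] inc] := IH _ _ sbs cov' sz'.
rewrite mem_filter => /andP [hc ccs]; exists c => //.
have := allP sz _ ccs; case: c hc inc {ccs} => //= o c hc inc _.
rewrite /in_cube /= -/(in_cube c bs) inc andbT.
by case: o hc => //= d; case: d b {cov cov' sz'} => [] [].
Qed.

Lemma path_arcs_of (e : rel nat) x s :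
  path e x s = all (fun a => e a.1 a.2) (arcs_of (x :: s)).
Proof. by elim: s x => //= y s IH x; rewrite IH. Qed.

Lemma in_cube_nth c bs n b :
  in_cube c bs -> nth None c n = Some b -> nth false bs n = b.
Proof.
elim: c bs n => [|o c IH] [|a bs] [|n] //=; rewrite /in_cube /=.
  by move=> /andP [h _] E; move: h; rewrite E => /eqP.
by move=> /andP [_ h]; apply: IH.
Qed.

Lemma valid_witness_theta12 i w bs :
  i <= 5 -> valid_witness i w ->
  in_cube (cube (literals (witness_arcs i w))) bs -> theta12 bs i.
Proof.
move=> i5 /and5P [/eqP sw w12 uw arcs /and3P [consistent V2 V1]] inc.
have ok a : a \in witness_arcs i w -> arc12 bs a.1 a.2.
  move=> aw; have /andP [par] := allP arcs _ aw; rewrite /arc12 /flipped.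
  case: (boolP (a.1 %/ 4 != a.2 %/ 4)) => /= [lay _|_]; last by rewrite addn0.
  have al : (flip_index a.1 a.2, a.2 != a.1 + 1 %[mod 4]) \in
      literals (witness_arcs i w).
    by apply/mapP; exists a => //; rewrite mem_filter lay.
  have /eqP /= := allP consistent _ al => /(in_cube_nth inc) ->.
  case E: (a.2 == a.1 + 1 %[mod 4]) => /=; first by rewrite addn0.
  by clear -par E; rewrite muln1; lia.
have Ew : w = head 0 w :: take i (behead w) ++ nth 0 w i.+1 :: drop i.+2 w.
  rewrite -{1}(cat_take_drop i.+1 w) (drop_nth 0) ?sw; last by lia.
  by case: w sw {w12 uw arcs consistent V2 V1 inc ok}.
have E1 : first_path i w = head 0 w :: rcons (take i (behead w)) (nth 0 w i.+1).
  rewrite /first_path (take_nth 0) ?sw; last by lia.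
  by case: w sw {w12 uw arcs consistent V2 V1 inc ok Ew}.
exists (head 0 w), (nth 0 w i.+1), (take i (behead w)), (drop i.+2 w); split.
- have: perm_eq w (iota 0 12).
    apply: uniq_perm; rewrite ?iota_uniq // => z.
    have sub : {subset w <= iota 0 12}.
      by move=> v /(allP w12) v12; rewrite mem_iota.
    by have [_ ->] := uniq_min_size uw sub ltac:(by rewrite sw).
  by rewrite {1}Ew; apply: perm_trans; rewrite perm_cons -cat1s perm_catCA.
- by rewrite size_take size_behead sw ifT //; lia.
- rewrite !path_arcs_of -E1; split; apply/allP=> a aw; apply: ok.
    by rewrite mem_cat aw.
  by rewrite mem_cat [X in _ || X]aw orbT.
- exact: V2.
- by move=> i2; move: V1; rewrite i2 E1.
Qed.

Lemma theta12_or_exceptional bs : size bs = 12 ->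
  (exists a b, bs = exceptional_bits a b) \/ (forall i, i <= 5 -> theta12 bs i).
Proof.
move=> sbs.
have [|nexc] := boolP [exists a, exists b, bs == exceptional_bits a b].
  by move=> /existsP [a /existsP [b /eqP E]]; left; exists a, b.
right=> i i5; have /andP [/allP val cov] : witnesses_ok i.
  by apply: (allP all_witnesses_ok); rewrite mem_iota.
have [|c + inc] := covers_in_cube sbs cov.
  apply/allP=> c; rewrite mem_cat => /orP [/allpairsP [[a b] [_ _ ->]]|] //.
  by move=> /mapP [w _ ->]; rewrite size_mkseq.
rewrite mem_cat.
move=> /orP [/allpairsP [[a b] [_ _ Ec]]|/mapP [w ww Ec]]; last first.
  by apply: valid_witness_theta12 (val _ ww) _; rewrite // -Ec.
(* A cube without free bits contains only its own bit sequence. *)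
case/negP: nexc; apply/existsP; exists a; apply/existsP; exists b; apply/eqP.
move: inc; rewrite Ec /in_cube; clear; move: (exceptional_bits _ _) => l.
by elim: l bs => [|d l IH] [|f bs] //= /andP [/eqP -> /IH ->].
Qed.

Lemma absorbs_nil (T : eqType) (e : rel T) x p :
  path e x p -> absorbs e x p [::].
Proof. by move=> ep; exists p; rewrite cats0. Qed.

Lemma absorbs_rcons (T : eqType) (e : rel T) x s y R :
  absorbs e x (rcons s y) R ->
  exists2 s', perm_eq s' (s ++ R) & path e x (rcons s' y).
Proof.
move=> [p' []]; rewrite last_rcons; case/lastP: p' => [|s' z] pR ep.
  by have := perm_size pR; rewrite size_cat size_rcons.
rewrite last_rcons => zy; rewrite zy in pR ep; exists s' => //.
rewrite -(perm_cons y); apply: perm_trans (_ : perm_eq _ (rcons s' y)) _.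
  by rewrite perm_sym perm_rcons.
by apply: perm_trans pR _; rewrite -cat_cons perm_cat2r perm_rcons.
Qed.

(** Each path takes up its own share of the new vertices; distinctness survives because only the
    order changes. *)
Lemma absorbs_theta (T : eqType) (e : rel T) x y s t R1 R2 :
  uniq (x :: y :: (s ++ t) ++ R1 ++ R2) ->
  absorbs e x (rcons s y) R1 -> absorbs e x (rcons t y) R2 ->
  theta e (size s + size R1) (size t + size R2).
Proof.
move=> U /absorbs_rcons [s' ps es] /absorbs_rcons [t' pt et].
exists x, y, s', t'; split=> //; last 2 first.
- by rewrite (perm_size ps) size_cat.
- by rewrite (perm_size pt) size_cat.
rewrite (perm_uniq (_ : perm_eq _ (x :: y :: (s ++ t) ++ R1 ++ R2))) //.
rewrite !perm_cons; apply: perm_trans (perm_cat ps pt) _.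
by rewrite -!catA perm_cat2l perm_catCA.
Qed.

Lemma absorbs_at_arc (T : eqType) (e : rel T) x p p1 p2 u v R :
  x :: p = p1 ++ u :: v :: p2 -> path e x p -> path e u (rcons R v) ->
  absorbs e x p R.
Proof.
case: p1 => [|x1 p1] /= [-> ->].
  rewrite /= => /andP [_ ep] eR; exists (R ++ v :: p2); split.
  - by rewrite perm_catC.
  - by move: eR; rewrite rcons_path cat_path /= ep andbT.
  - by rewrite last_cat.
rewrite cat_path /= => /and4P [e1 e2 _ ep] eR.
exists (p1 ++ u :: R ++ v :: p2); split.
- by rewrite -catA perm_cat2l cat_cons perm_cons perm_catC.
- by move: eR; rewrite cat_path /= e1 e2 rcons_path cat_path /= ep andbT.
- by rewrite !last_cat /= last_cat.
Qed.

Lemma has_inner_arcP s : has_inner_arc s ->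
  exists p1 p2 u v, [/\ s = p1 ++ u :: v :: p2, 4 <= u & 4 <= v].
Proof.
elim: s => [|a [|b s] IH] //=; rewrite /has_inner_arc /= => /orP [|/IH].
  by move=> /andP [a4 b4]; exists [::], s, a, b.
by move=> [p1 [p2 [u [v [-> u4 v4]]]]]; exists (a :: p1), p2, u, v.
Qed.

(** Here [t a b r] is meant as the type of vertex [r] of layer [b] with respect to the cycle of
    layer [a < b]. The order of the three groups is that of [flip_index]. *)
Definition layer_bits (t : nat -> nat -> nat -> nat) : bitseq :=
  [seq t 0 1 r != r %[mod 4] | r <- iota 0 4] ++
  [seq t 0 2 r != r %[mod 4] | r <- iota 0 4] ++
  [seq t 1 2 r != r %[mod 4] | r <- iota 0 4].

Lemma nth_layer_bits t a b r : a < b -> b < 3 -> r < 4 ->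
  nth false (layer_bits t) (4 * (a + b).-1 + r) = (t a b r != r %[mod 4]).
Proof.
by case: b a r => [|[|[|b]]] [|[|a]] [|[|[|[|r]]]].
Qed.

(** A type has the parity of its position [r], so it is [r] or [r + 2] modulo 4 and one bit
    describes it. *)
Lemma arc12_layers (T : Type) (e : rel T) (d : nat -> nat -> T) t :
  (forall a q r, a < 3 -> q < 4 -> r < 4 ->
    e (d a q) (d a r) = (r == q + 1 %[mod 4])) ->
  (forall a b q r, a < b -> b < 3 -> q < 4 -> r < 4 ->
    [/\ e (d a q) (d b r) = (t a b r == q + 1 %[mod 4]),
        e (d b r) (d a q) = (q == t a b r + 1 %[mod 4]) &
        odd (t a b r) = odd r]) ->
  forall x y, x < 12 -> y < 12 ->
    e (d (x %/ 4) (x %% 4)) (d (y %/ 4) (y %% 4)) = arc12 (layer_bits t) x y.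
Proof.
move=> same diff x y x12 y12; rewrite /arc12 /flipped.
have [x3 y3] : x %/ 4 < 3 /\ y %/ 4 < 3 by lia.
have [xr yr] : x %% 4 < 4 /\ y %% 4 < 4 by lia.
case: (ltngtP (x %/ 4) (y %/ 4)) => xy.
- have [-> _ par] := diff _ _ _ _ xy y3 xr yr.
  rewrite /flip_index (maxn_idPr _) ?nth_layer_bits //; last by lia.
  by move: (t _ _ _) par => u; clear; lia.
- have [_ -> par] := diff _ _ _ _ xy x3 yr xr.
  rewrite /flip_index (maxn_idPl _); last by lia.
  rewrite (addnC (x %/ 4)) nth_layer_bits //.
  by move: (t _ _ _) par => u; clear; lia.
- by rewrite xy same //; lia.
Qed.

Definition exceptional_color (a b : bool) (x : nat) : nat :=
  x + 2 * (if x < 4 then false else if x < 8 then a else b).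

Lemma arc12_exceptional a b x y : x < 12 -> y < 12 ->
  arc12 (exceptional_bits a b) x y =
    (exceptional_color a b y == exceptional_color a b x + 1 %[mod 4]).
Proof.
have/allP H : all (fun c => all (fun d => all (fun u => all (fun v =>
    arc12 (exceptional_bits c d) u v ==
    (exceptional_color c d v == exceptional_color c d u + 1 %[mod 4]))
    (iota 0 12)) (iota 0 12)) [:: false; true]) [:: false; true].
  by vm_compute.
move=> x12 y12; have /allP Ha := H a ltac:(by case: (a)).
have /allP Hb := Ha b ltac:(by case: (b)).
have /allP Hx := Hb x ltac:(by rewrite mem_iota).
by have /eqP -> := Hx y ltac:(by rewrite mem_iota).
Qed.

(** * Peeling off 4-cycles *)

Lemma card_decomposable k (T : finType) (e : rel T) :
  decomposable_bt k.+1 e -> #|T| = 4 * k.+1.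
Proof.
elim: k T e => [|k IH] T e /=.
  by move=> [f fb _]; rewrite (bij_eq_card fb) card_ord.
move=> [_ _ [S [[f fb _] dec]]].
have cS : #|S| = 4 by have := bij_eq_card fb; rewrite card_ord card_sig.
have cS' : #|~: S| = 4 * k.+1 by have := IH _ _ dec; rewrite card_sig.
by rewrite -(cardsC S) cS cS'; lia.
Qed.

(** Vertices with colours of opposite parity are adjacent, so the sides are the colour parities up
    to an exchange, which a shift of all colours by 1 undoes. *)
Lemma blowup_side k (T : finType) (e : rel T) side col (x0 : T) :
  bipartition e side -> blowup e col -> regular_digraph k.+1 e ->
  exists2 col', blowup e col' & forall v, side v = odd (col' v).
Proof.
move=> [bip _] bl reg.
have adj u v : odd (col u) != odd (col v) -> side u != side v.
  move=> uv.
  have [E|E] : col v == col u + 1 %[mod 4] \/ col u == col v + 1 %[mod 4].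
  - by clear -uv; lia.
  - by apply: bip; rewrite bl.
  - by rewrite eq_sym; apply: bip; rewrite bl.
pose d := nat_of_bool (side x0 (+) odd (col x0)).
exists (fun v => col v + d) => [u v|v]; first by rewrite bl; clear; lia.
rewrite oddD oddb.
case: (boolP (odd (col v) == odd (col x0))) => [/eqP vx|vx]; last first.
  move: vx (adj _ _ vx).
  by case: (odd (col v)) (odd (col x0)) (side v) (side x0) => [] [] [] [].
(* If [v] and [x0] have the same colour parity, a vertex [w] of the next colour is adjacent to both
   and puts them on the same side. *)
have := card_color_class bl reg x0 (col v + 1).
have [->|[w]] := set_0Vmem [set y | col y == col v + 1 %[mod 4]].
  by rewrite cards0.
rewrite inE => wv _.
have wv' : odd (col w) != odd (col v) by clear -wv; lia.
move: (adj _ _ wv'); move: wv'; rewrite {1}vx => /adj; rewrite vx.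
by case: (odd (col x0)) (side w) (side v) (side x0) => [] [] [] [].
Qed.

(** * Transversal 4-cycles of a blow-up *)

Section Blocks.
Variables (T : eqType) (e : rel T) (n : nat) (h : nat -> T).
Hypothesis arch : forall x y, x < 4 * n -> y < 4 * n ->
  e (h x) (h y) = (y == x + 1 %[mod 4]).

Definition block q := [seq h (4 * q + r) | r <- iota 0 4].

(** Each block is entered at the colour after that of [h a] and left at the colour of [h a], so its
    last vertex can be continued exactly as [h a] could. *)
Lemma path_blocks Q a b : all (gtn n) Q -> a < 4 * n -> b < 4 * n ->
  b == a + 1 %[mod 4] ->
  exists2 R, perm_eq R (flatten [seq block q | q <- Q]) &
             path e (h a) (rcons R (h b)).
Proof.
elim: Q a => [|q Q IH] a /= => [_ an bn ba|/andP [qn Qn] an bn ba].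
  by exists [::]; rewrite //= arch // ba.
pose p s := 4 * q + (a + s) %% 4.
have pn s : p s < 4 * n by rewrite /p; lia.
have [||||R pR eR] := IH (p 4) => //; first by rewrite /p; lia.
exists ([seq h (p s) | s <- iota 1 4] ++ R).
  apply: (@perm_cat _ _ (block q) _ _ _ pR).
  suff -> : [seq h (p s) | s <- iota 1 4] = rot ((a + 1) %% 4) (block q).
    by rewrite perm_rot.
  rewrite /p /block /= -!(modnDml a); have := ltn_pmod a (isT : 0 < 4).
  by case: (a %% 4) => [|[|[|[|]]]].
rewrite rcons_cat cat_path /= eR andbT !arch //; apply/and4P; split => //.
all: by rewrite /p; clear; lia.
Qed.

End Blocks.

Lemma uniq_blocks (T : eqType) (h : nat -> T) n Q :
  {in gtn (4 * n) &, injective h} -> all (gtn n) Q -> uniq Q ->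
  uniq (flatten [seq block h q | q <- Q]).
Proof.
move=> hinj; elim: Q => [|q Q IH] // /andP [/= qn Qn] /andP [qQ uQ].
have uq : uniq (block h q).
  rewrite /block map_inj_in_uniq ?iota_uniq // => r s.
  rewrite !mem_iota => r4 s4.
  by move/hinj; rewrite !inE => /(_ ltac:(lia) ltac:(lia)); lia.
change (uniq (block h q ++ flatten [seq block h q | q <- Q])).
rewrite cat_uniq uq IH // andbT andTb.
apply/hasPn=> x /flatten_mapP [r rQ] /mapP [s s4 ->].
apply/negP => /mapP [u u4].
rewrite !mem_iota in s4 u4; have rn := allP Qn _ rQ; rewrite /= in rn.
move/hinj; rewrite !inE => /(_ ltac:(lia) ltac:(lia)) E.
by move: qQ; rewrite (_ : q = r) ?rQ //; lia.
Qed.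

(** Each of [R1] and [R2] is inserted as a whole into one inner arc of its path. For [i <= 1] no
    inner arc is guaranteed on the first path, hence the condition on [R1]. *)
Lemma theta12_theta (T : eqType) (e : rel T) bs i j (L : nat -> T) R1 R2 :
  theta12 bs i ->
  (forall x y, x < 12 -> y < 12 -> e (L x) (L y) = arc12 bs x y) ->
  uniq ([seq L x | x <- iota 0 12] ++ R1 ++ R2) ->
  i + j = 10 -> (1 < i) || (R1 == [::]) ->
  (forall u v, 4 <= u < 12 -> 4 <= v < 12 -> e (L u) (L v) ->
     exists2 R, perm_eq R R1 & path e (L u) (rcons R (L v))) ->
  (forall u v, 4 <= u < 12 -> 4 <= v < 12 -> e (L u) (L v) ->
     exists2 R, perm_eq R R2 & path e (L u) (rcons R (L v))) ->
  theta e (i + size R1) (j + size R2).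
Proof.
move=> [x [y [s [t [pxy ss [es et] It Is]]]]] arcL U ij iR1 ins1 ins2.
have in12 z : z \in x :: y :: s ++ t -> z < 12.
  by rewrite (perm_mem pxy) mem_iota.
have pathL p : {subset p <= x :: y :: s ++ t} -> path (arc12 bs) x p ->
    path e (L x) [seq L z | z <- p].
  move=> sub; apply: (@homo_path_in _ _ (gtn 12)) => [u v u12 v12|].
    by rewrite arcL.
  rewrite /= in12 ?mem_head //=; apply/allP=> z /sub /in12 //.
have insert p R : {subset p <= x :: y :: s ++ t} -> path (arc12 bs) x p ->
    has_inner_arc (x :: p) ->
    (forall u v, 4 <= u < 12 -> 4 <= v < 12 -> e (L u) (L v) ->
      exists2 R', perm_eq R' R & path e (L u) (rcons R' (L v))) ->
    absorbs e (L x) [seq L z | z <- p] R.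
  move=> sub ep /has_inner_arcP [p1 [p2 [u [v [E u4 v4]]]]] ins.
  have sub' z : z \in x :: p -> z < 12.
    by rewrite inE => /orP [/eqP ->|/sub]; [rewrite in12 ?mem_head|apply: in12].
  have [u12 v12] : u < 12 /\ v < 12.
    by split; apply: sub'; rewrite E mem_cat !inE eqxx ?orbT.
  have epL := pathL _ sub ep.
  have EL : L x :: [seq L z | z <- p] =
      [seq L z | z <- p1] ++ L u :: L v :: [seq L z | z <- p2].
    by rewrite -map_cons E map_cat.
  have euv : e (L u) (L v).
    have: sorted e (L x :: [seq L z | z <- p]) by [].
    by rewrite EL sorted_cat_cons => /and3P [].
  have [R' pR' eR'] := ins u v ltac:(by rewrite u4) ltac:(by rewrite v4) euv.
  have [p' [pp' ep' lp']] := absorbs_at_arc EL epL eR'.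
  by exists p'; split=> //; apply: perm_trans pp' _; rewrite perm_cat2l.
have subs : {subset rcons s y <= x :: y :: s ++ t}.
  by move=> z; rewrite mem_rcons !inE mem_cat => /orP [|] ->; rewrite ?orbT.
have subt : {subset rcons t y <= x :: y :: s ++ t}.
  by move=> z; rewrite mem_rcons !inE mem_cat => /orP [|] ->; rewrite ?orbT.
have st : size t = j.
  by have := perm_size pxy; rewrite /= size_cat ss; clear -ij; lia.
rewrite -ss -st -(size_map L s) -(size_map L t).
apply: (@absorbs_theta _ _ (L x) (L y)).
- have := perm_map L pxy; rewrite -(perm_cat2r (R1 ++ R2)) => /perm_uniq.
  by rewrite U /= map_cat.
- rewrite -map_rcons; case: (ltnP 1 i) iR1 => [i2 _|_ /= /eqP ->].
    by apply: insert => //; apply: Is.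
  by apply: absorbs_nil; apply: pathL.
- by rewrite -map_rcons; apply: insert.
Qed.

Lemma theta_wlog (T : eqType) (e : rel T) n :
  (forall i j, i <= j -> i + j = n -> theta e i j) ->
  forall i j, i + j = n -> theta e i j.
Proof.
move=> th i j ij; case: (leqP i j) => [le|/ltnW le]; first exact: th.
by apply: theta_sym; apply: th; rewrite // addnC.
Qed.

(** Peeling twice leaves a third 4-cycle. Vertex [4a + r] is position [r] of layer [a], and the bits
    recording the types are either exceptional or served by the table. *)
Lemma decomposable3_theta (T : finType) (e : rel T) side :
  bipartition e side -> decomposable_bt 3 e ->
  (exists col, blowup e col) \/ (forall i j, i + j = 10 -> theta e i j).
Proof.
move=> bip dec; have cT := card_decomposable dec.
have [S [c [ty [fr dec1]]]] := decomposable_framed bip dec.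
have bip1 := bipartition_induced (~: S) bip.
have [S1 [c1 [ty1 [fr1 dec2]]]] := decomposable_framed bip1 dec1.
have [c2 [_ arc2 surj2 side2]] :=
  dicycle4_enum_side (bipartition_induced (~: S1) bip1) dec2.
pose d a r := match a with
  | 0 => c r | 1 => val (c1 r) | _ => val (val (c2 r)) end.
pose t a b r := match a, b with
  | 0, 1 => ty (val (c1 r)) | 0, _ => ty (val (val (c2 r)))
  | _, _ => ty1 (val (c2 r)) end.
pose L x := d (x %/ 4) (x %% 4); pose bs := layer_bits t.
have side1 r : side (val (c1 r)) = odd r.
  have := framed_side fr1 (c1 r); have := framed_ty fr1 r.
  by rewrite /= => h ->; clear -h; lia.
have arcL x y : x < 12 -> y < 12 -> e (L x) (L y) = arc12 bs x y.
  apply: arc12_layers => [a q r|a b q r].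
    case: a => [|[|[|a]]] // _ _ _.
    - by rewrite (framed_to fr); have := framed_ty fr r; clear; lia.
    - by have := framed_to fr1 q (c1 r); have := framed_ty fr1 r;
        rewrite /induced /= => h ->; clear -h; lia.
    - exact: arc2.
  case: a b => [|[|a]] [|[|[|b]]] // _ _ _ _; split.
  - exact: framed_to fr _ _.
  - exact: framed_from fr _ _.
  - by rewrite -(framed_side fr) side1.
  - exact: framed_to fr _ _.
  - exact: framed_from fr _ _.
  - by rewrite -(framed_side fr); apply: side2.
  - exact: framed_to fr1 _ _.
  - exact: framed_from fr1 _ _.
  - by rewrite -(framed_side fr1); apply: side2.
have surjL v : exists2 x, x < 12 & L x = v.
  case: (boolP (v \in S)) => [/(framed_cover fr) [i i4 <-]|vS].
    by exists i; [lia|rewrite /L divn_small ?modn_small].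
  have vS' : v \in ~: S by rewrite inE.
  case: (boolP (Sub v vS' \in S1)) => [/(framed_cover fr1) [i i4 Ei]|vS1].
    exists (i + 4); first by lia.
    by rewrite /L divnDr // divn_small // modnDr modn_small //= Ei.
  have vS1' : Sub v vS' \in ~: S1 by rewrite inE.
  have [i i4 Ei] := surj2 (Sub (Sub v vS') vS1'); exists (i + 8); first by lia.
  rewrite /L divnDr // divn_small // (_ : (i + 8) %% 4 = i) /= ?Ei //.
  by clear -i4; lia.
have memL v : v \in [seq L x | x <- iota 0 12].
  by have [x x12 <-] := surjL v; apply: map_f; rewrite mem_iota.
have uniqL : uniq [seq L x | x <- iota 0 12].
  by apply/card_uniqP; rewrite size_map size_iota (eq_card memL) cT.
have [[a [b Ebs]]|th] := @theta12_or_exceptional bs erefl; [left|right].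
  (* [ix] inverts the numbering [L] and transports the colouring of the exceptional 12-vertex
     digraph. *)
  pose ix v := index v [seq L x | x <- iota 0 12].
  have ix12 v : ix v < 12 by have := memL v; rewrite -index_mem size_map.
  have ixK v : L (ix v) = v.
    have := nth_index v (memL v); rewrite (nth_map 0) ?size_iota ?ix12 //.
    by rewrite nth_iota ?ix12.
  exists (fun v => exceptional_color a b (ix v)) => u v.
  by rewrite -{1}(ixK u) -{1}(ixK v) arcL // Ebs arc12_exceptional.
apply: theta_wlog => i j ij i_j; rewrite -(addn0 i) -(addn0 j).
apply: (@theta12_theta _ e bs i j L [::] [::]) => //.
- by apply: th; clear -ij i_j; lia.
- by rewrite orbT.
- by move=> u v _ _ euv; exists [::]; rewrite //= euv.
- by move=> u v _ _ euv; exists [::]; rewrite //= euv.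
Qed.

(* (i0, 10 - i0) are the lengths in a 12-vertex tournament from which (i, j) is
   reached by inserting m and k - m further 4-cycles; [theta12] provides an inner
   arc on the first path only for 1 < i0. *)
Lemma split_lengths k i j : i <= j -> i + j = 4 * k + 10 ->
  exists i0 m, [/\ i0 <= 5, (1 < i0) || (m == 0), m <= k,
    i = i0 + 4 * m & j = 10 - i0 + 4 * (k - m)].
Proof.
move=> ij i_j; case: (ltnP i 2) => i2.
  by exists i, 0; rewrite eqxx orbT muln0 addn0 subn0; split=> //; lia.
(* The residue of [i] modulo 4 is represented by [i0] in 2, .., 5, where both paths have an inner
   arc. *)
have := divn_eq (i - 2) 4; have := ltn_pmod (i - 2) (isT : 0 < 4).
move: (_ %% 4) (_ %/ 4) => r m r4 E; exists (2 + r), m.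
have Ei : i = 2 + r + 4 * m by lia.
have mk : m <= k by clear -ij i_j Ei; lia.
by split=> //; clear -mk r4 Ei i_j; lia.
Qed.

(** Types [u], [v] differ from positions [x], [y] by 0 or 2 modulo 4, and a common shift cancels. *)
Lemma same_flip u v x y : odd u = odd x -> odd v = odd y ->
  (u != x %[mod 4]) = (v != y %[mod 4]) ->
  (y == x + 1 %[mod 4]) = (v == u + 1 %[mod 4]).
Proof.
case: (boolP (u == x %[mod 4])) (boolP (v == y %[mod 4])) => [ux|ux] [vy|vy] //.
  by clear -ux vy; lia.
move=> ou ov _.
have ux2 : u = x + 2 %[mod 4] by clear -ux ou; lia.
have vy2 : v = y + 2 %[mod 4] by clear -vy ov; lia.
by clear -ux2 vy2; lia.
Qed.

(** [fl x] tells whether the type of [h x] with respect to [c] deviates from its position. If [fl]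
    is constant, [ty] colours the whole digraph as a blow-up; otherwise two blocks on which it
    varies form a non-exceptional 12-vertex tournament with [c]. *)
Lemma framed_blowup_theta k (T : finType) (e : rel T) side S c ty col :
  bipartition e side -> framed e side S c ty ->
  regular_digraph k.+2 (induced T e (~: S)) -> #|~: S| > 0 ->
  blowup (induced T e (~: S)) col ->
  (exists col', blowup e col') \/
  (forall i j, i + j = 4 * k + 10 -> theta e i j).
Proof.
move=> bip fr reg ne bl0; have bip1 := bipartition_induced (~: S) bip.
have /card_gt0P [z0 z0S] := ne; pose x0 : {x | x \in ~: S} := Sub z0 z0S.
have [{bl0} {}col bl colside] := blowup_side x0 bip1 bl0 reg.
have [g [colg ginj gsurj]] := blowup_enum bl reg x0.
pose n := k.+2; pose h x := val (g x).
have hS x : h x \notin S by have := valP (g x); rewrite inE.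
have archx x y : x < 4 * n -> y < 4 * n ->
    e (h x) (h y) = (y == x + 1 %[mod 4]).
  move=> xn yn; have := bl (g x) (g y); rewrite /induced => ->.
  by have := colg _ xn; have := colg _ yn; clear; lia.
have sideh x : x < 4 * n -> odd (ty (h x)) = odd x.
  move=> xn; rewrite -(framed_side fr); have := colside (g x).
  by rewrite /= => ->; have := colg _ xn; clear; lia.
have hinj : {in gtn (4 * n) &, injective h}.
  by move=> x y xn yn /val_inj; apply: ginj.
pose fl x := ty (h x) != x %[mod 4].
have [const|] := boolP (all (fun x => fl x == fl 0) (iota 0 (4 * n))).
  left; exists ty => u v.
  case: (boolP (u \in S)) => [/(framed_cover fr) [i _ <-]|uS].
    by rewrite (framed_to fr); have := framed_ty fr i; clear; lia.
  case: (boolP (v \in S)) => [/(framed_cover fr) [i _ <-]|vS].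
    by rewrite (framed_from fr); have := framed_ty fr i; clear; lia.
  have hsurj w : w \notin S -> exists2 x, x < 4 * n & h x = w.
    move=> wS; have wS' : w \in ~: S by rewrite inE.
    by have [x xn E] := gsurj (Sub w wS'); exists x; rewrite // /h E.
  have [[x xn <-] [y yn <-]] := (hsurj _ uS, hsurj _ vS).
  rewrite archx //; apply: same_flip; rewrite ?sideh //.
  have := allP const x; rewrite mem_iota => /(_ xn) /eqP; rewrite /fl => ->.
  by have := allP const y; rewrite mem_iota => /(_ yn) /eqP; rewrite /fl => ->.
move=> /allPn [x1]; rewrite mem_iota => /andP [_ x1n] nfl; right.
have [q2 [q2n q20 nfl2]] : exists q2, [/\ q2 < n, q2 != 0 &
    ~ (forall x, x %/ 4 == 0 \/ x %/ 4 == q2 -> fl x = fl 0)].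
  (* Block 0 is always used. If it contains the deviating [x1] already, any other block will do as
     the second one. *)
  exists (if x1 %/ 4 == 0 then 1 else x1 %/ 4); split.
  - by rewrite /n in x1n *; clear -x1n; case: ifP; lia.
  - by case: (x1 %/ 4).
  - move=> /(_ x1) H; case/negP: nfl; apply/eqP; apply: H.
    by case: (x1 %/ 4 == 0); [left|right].
pose d a r := match a with
  | 0 => c r | 1 => h (4 * 0 + r) | _ => h (4 * q2 + r) end.
pose t a b r := match a, b with
  | 0, 1 => ty (h (4 * 0 + r)) | 0, _ => ty (h (4 * q2 + r)) | _, _ => r end.
pose L x := d (x %/ 4) (x %% 4); pose bs := layer_bits t.
have b0 r : r < 4 -> 4 * 0 + r < 4 * n by rewrite /n; clear; lia.
have b2 r : r < 4 -> 4 * q2 + r < 4 * n by move: q2n; clear; lia.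
have arcL x y : x < 12 -> y < 12 -> e (L x) (L y) = arc12 bs x y.
  apply: arc12_layers => [a q r|a b q r].
    case: a => [|[|[|a]]] // _ q4 r4.
    - by rewrite (framed_to fr); have := framed_ty fr r; clear; lia.
    - by rewrite /= archx ?b0 //; clear; lia.
    - by rewrite /= archx ?b2 //; clear; lia.
  case: a b => [|[|a]] [|[|[|b]]] // _ _ q4 r4; split=> //.
  - exact: framed_to fr _ _.
  - exact: framed_from fr _ _.
  - by rewrite /= sideh ?b0.
  - exact: framed_to fr _ _.
  - exact: framed_from fr _ _.
  - by rewrite /= sideh ?b2 //; clear; lia.
  - by rewrite /t /= archx ?b2 ?b0 //; clear; lia.
  - by rewrite /t /= archx ?b2 ?b0 //; clear; lia.
have [[a [b Ebs]]|th] := @theta12_or_exceptional bs erefl.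
  case: nfl2 => x xq.
  have Ebit r : r < 12 -> nth false bs r = nth false (exceptional_bits a b) r.
    by rewrite Ebs.
  (* Bits 8 to 11 vanish, since both blocks belong to the same blow-up; thus [a] and [b] agree and
     [fl] would be constant on the two blocks. *)
  have ab : a = b by move: (Ebit 8 isT); case: a b {Ebs Ebit} => [] [].
  have f0 r : r < 4 -> fl r = a.
    move=> r4; have := nth_layer_bits t (isT : 0 < 1) isT r4.
    rewrite -/bs Ebit; last by clear -r4; lia.
    by case: r r4 => [|[|[|[|]]]].
  have f2 r : r < 4 -> fl (4 * q2 + r) = a.
    move=> r4; have := nth_layer_bits t (isT : 0 < 2) isT r4.
    rewrite -/bs Ebit; last by clear -r4; lia.
    rewrite ab /fl /t (_ : (4 * q2 + r) %% 4 = r %% 4) => [<-|]; last first.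
      by clear; lia.
    by case: r r4 => [|[|[|[|]]]].
  rewrite (f0 0) //; case: xq => xq; first by apply: f0; clear -xq; lia.
  by rewrite (_ : x = 4 * q2 + x %% 4) ?f2 ?ltn_pmod //; clear -xq; lia.
pose Q := rem q2 (iota 1 k.+1).
have pQ : perm_eq (0 :: q2 :: Q) (iota 0 n).
  have q2I : q2 \in iota 1 k.+1.
    by rewrite mem_iota; move: q2n q20; rewrite /n; clear; lia.
  by rewrite /n perm_cons perm_sym; apply: perm_to_rem q2I.
have /= sQ := perm_size pQ; rewrite size_iota in sQ.
have Qn : all (gtn n) (0 :: q2 :: Q).
  by rewrite (perm_all _ pQ); apply/allP=> q; rewrite mem_iota.
have uQ : uniq (flatten [seq block h q | q <- 0 :: q2 :: Q]).
  by apply: uniq_blocks hinj Qn _; rewrite (perm_uniq pQ) iota_uniq.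
have Lh u : 4 <= u < 12 -> exists2 x, x < 4 * n & L u = h x.
  move=> u4; rewrite /L; have r4 : u %% 4 < 4 by rewrite ltn_pmod.
  have [->|->] : u %/ 4 = 1 \/ u %/ 4 = 2 by clear -u4; lia.
    by exists (4 * 0 + u %% 4); rewrite ?b0.
  by exists (4 * q2 + u %% 4); rewrite ?b2.
have ins Q' : all (gtn n) Q' -> forall u v, 4 <= u < 12 -> 4 <= v < 12 ->
    e (L u) (L v) -> exists2 R, perm_eq R (flatten [seq block h q | q <- Q']) &
    path e (L u) (rcons R (L v)).
  move=> Q'n u v /Lh [x xn ->] /Lh [y yn ->]; rewrite archx // => xy.
  exact: path_blocks archx _ _ _ Q'n xn yn xy.
have Qn' : all (gtn n) Q by case/and3P: Qn.
apply: theta_wlog => i j ij i_j.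
have [i0 [m [i05 i01 mk Ei Ej]]] := split_lengths ij i_j.
(* The [k] blocks other than 0 and [q2] are shared out: [m] to the first path, the rest to the
   second. *)
pose R1 := flatten [seq block h q | q <- take m Q].
pose R2 := flatten [seq block h q | q <- drop m Q].
have size_blocks Q' : size (flatten [seq block h q | q <- Q']) = 4 * size Q'.
  by elim: Q' => //= q Q' ->; clear; lia.
have sQk : size Q = k by move: sQ; rewrite /n => -[].
have -> : i = i0 + size R1 by rewrite size_blocks size_takel ?sQk.
have -> : j = 10 - i0 + size R2 by rewrite size_blocks size_drop sQk.
apply: (theta12_theta (th _ i05) arcL).
- rewrite -flatten_cat -map_cat cat_take_drop.
  change (uniq ([seq c r | r <- iota 0 4] ++
    flatten [seq block h q | q <- 0 :: q2 :: Q])).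
  rewrite cat_uniq uQ andbT; apply/andP; split.
    rewrite map_inj_in_uniq ?iota_uniq // => r s; rewrite !mem_iota => r4 s4 E.
    have := framed_ty fr r; rewrite E; have := framed_ty fr s.
    by clear -r4 s4; lia.
  apply/hasPn=> v /flatten_mapP [q _ /mapP [r _ ->]].
  apply/negP=> /mapP [s _ E]; have := hS (4 * q + r).
  by rewrite E (framed_in fr).
- by clear -i05; lia.
- by case/orP: i01 => [->|/eqP m0] //; rewrite /R1 m0 take0 orbT.
- by apply: ins; apply/allP=> q /mem_take; apply: (allP Qn').
- by apply: ins; apply/allP=> q /mem_drop; apply: (allP Qn').
Qed.

(** Induction on peeled cycles: either the rest is a blow-up, treated by [framed_blowup_theta], or
    it has all path pairs and the second path absorbs [c]. *)
Lemma decomposable_theta k (T : finType) (e : rel T) side :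
  bipartition e side -> decomposable_bt k.+3 e ->
  (exists col, blowup e col) \/ (forall i j, i + j = 4 * k + 10 -> theta e i j).
Proof.
elim: k T e side => [|k IH] T e side bip dec.
  exact: decomposable3_theta bip dec.
have [S [c [ty [fr dec1]]]] := decomposable_framed bip dec.
have [[col bl]|th] := IH _ _ _ (bipartition_induced (~: S) bip) dec1.
  apply: framed_blowup_theta bip fr (decomposable_regular dec1) _ bl.
  by have := card_decomposable dec1; rewrite card_sig => ->.
right; apply: theta_wlog => i j ij i_j.
(* From [i <= j] and a total of at least 14 follows [j >= 7], so the second path of the rest has the
   three arcs required for absorption. *)
have [x [y [s [t [U ss st es et]]]]] := th i (j - 4) ltac:(clear -ij i_j; lia).
have -> : i = size [seq val z | z <- s] + size (Nil T).
  by rewrite size_map ss addn0.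
have -> : j = size [seq val z | z <- t] + size [:: c 0; c 1; c 2; c 3].
  by rewrite size_map st /=; clear -ij i_j; lia.
have pathv p : path (induced T e (~: S)) x p ->
    path e (val x) [seq val z | z <- p].
  by rewrite path_map.
apply: (@absorbs_theta _ _ (val x) (val y)).
- pose W := [seq val z | z <- x :: y :: s ++ t]; rewrite -map_cat cat0s.
  have uW : uniq W by rewrite map_inj_uniq //; apply: val_inj.
  change (uniq (W ++ [:: c 0; c 1; c 2; c 3])).
  have cc i1 i2 : i1 < 4 -> i2 < 4 -> i1 != i2 -> c i1 != c i2.
    move=> h1 h2; apply: contra => /eqP E.
    have := framed_ty fr i1; rewrite E; have := framed_ty fr i2.
    by clear -h1 h2; lia.
  have cn r : c r \notin W.
    apply/negP=> /mapP [z _ E]; have := valP z; rewrite inE -E.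
    by rewrite (framed_in fr).
  by clearbody W; rewrite cat_uniq uW /= !inE !negb_or !cc // !cn.
- by rewrite -map_rcons; apply: absorbs_nil; apply: pathv.
- rewrite -map_rcons; apply: framed_absorbs bip fr (pathv _ et) _.
  by rewrite size_map size_rcons st; clear -ij i_j; lia.
Qed.

Theorem theorem3p1 (k : nat) (T : finType) (BT : rel T) :
  3 <= k ->
  decomposable_bt k BT ->
  ~ digraph_iso BT (exceptional k) ->
  forall p : nat, 2 <= p <= 4 * k -> contains_spanning BT (Dnp (4 * k) p).
Proof.
case: k => [|[|[|k]]] // _ dec nexc p hp.
have cT := card_decomposable dec; have reg := decomposable_regular dec.
have [side bip] : exists side, bipartition BT side.
  by case: dec => bt _ _; apply: bipartite_tournament_side.
have [[col bl]|th] := decomposable_theta bip dec.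
  have /card_gt0P [x0 _] : 0 < #|T| by rewrite cT.
  (* A regular blow-up is the excluded digraph. *)
  by case: nexc; apply: blowup_exceptional bl reg x0.
have sum : p - 2 + (4 * k.+3 - p) = 4 * k + 10 by clear -hp; lia.
exact: theta_contains cT hp (th _ _ sum).
Qed.
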